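(* (p-validity of one-premise centering for conditional events.) Let $A,B,H,K$ be logically independent events. Then the inference from $(A|H)\wedge(B|K)$ to $(B|K)|(A|H)$ is p-valid, i.e. $(B|K)\wedge(A|H)$ p-entails $(B|K)|(A|H)$: if $\mathbb P[(B|K)\wedge(A|H)]=1$, then $\mathbb P[(B|K)|(A|H)]=1$.
   Context: Events are two-valued logical entities; $\Omega$ is the sure event, $\emptyset$ the impossible event, $\overline E$ is negation, $EF$ is conjunction, and an event is identified with its $0/1$ indicator. Events $E_1,\dots,E_n$ are logically independent if all $2^n$ conjunctions of the $E_i$ or their negations are different from $\emptyset$. Conditional random quantities and prevision. For an event $H\neq\emptyset$ and a finite random quantity $X$, assessing the conditional prevision $\mathbb P(X|H)=\mu$ means, in de Finetti's betting scheme, that for every real $s$ one is willing to pay $\mu s$ and to receive $Xs$ if $H$ is true and $\mu s$ if $H$ is false (bet called off). The symbol $X|H$ denotes the random quantity $XH+\mu\overline H$. When $X$ is (the indicator of) an event $A$, $\mathbb P(X|H)$ is the probability $P(A|H)$, and the conditional event $A|H$ is, numerically, $AH+P(A|H)\overline H$. Coherence. A prevision function $\mathbb P$ on a family $\mathcal K$ of finite conditional random quantities is coherent if, for every $n\ge1$, every finite subfamily $\{X_1|H_1,\dots,X_n|H_n\}\subseteq\mathcal K$ with $\mu_i=\mathbb P(X_i|H_i)$, and all real $s_1,\dots,s_n$, the set $D$ of values of the random gain $\sum_i s_iH_i(X_i-\mu_i)$ restricted to $H_1\vee\cdots\vee H_n$ satisfies $\min D\le 0\le\max D$. Conjunction.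 With $P(A|H)=x$ and $P(B|K)=y$, $(A|H)\wedge(B|K)=(B|K)\wedge(A|H)$ is the conditional random quantity $\min\{AH+x\overline H,\;BK+y\overline K\}\,|\,(H\vee K)$. With $z=\mathbb P[(A|H)\wedge(B|K)]$, it equals $1$ if $AHBK$ is true, $0$ if $\overline AH\vee\overline BK$ is true, $x$ if $\overline HBK$ is true, $y$ if $AH\overline K$ is true, and $z$ if $\overline H\,\overline K$ is true. Iterated conditional. $(B|K)|(A|H)$ is the conditional random quantity $(B|K)\wedge(A|H)+\mu\cdot(\overline A|H)$, where $\mu=\mathbb P[(B|K)|(A|H)]$ and $\overline A|H=\overline AH+(1-x)\overline H$. In the betting scheme $\mu$ is the amount one agrees to pay in order to receive this quantity, which equals $1$ if $AHBK$ is true, $0$ if $AH\overline BK$ is true, $y$ if $AH\overline K$ is true, $\mu$ if $\overline AH$ is true, $x+\mu(1-x)$ if $\overline HBK$ is true, $\mu(1-x)$ if $\overline H\,\overline BK$ is true, and $z+\mu(1-x)$ if $\overline H\,\overline K$ is true. Both the conjunction and the iterated conditional take values in $[0,1]$. p-consistency, p-entailment, p-validity. A finite family $\{X_1|H_1,\dots,X_n|H_n\}$ of conditional random quantities taking values in a finite subset of $[0,1]$ is p-consistent if the prevision assessment $(1,\dots,1)$ on it is coherent. A p-consistent family $\{X_1|H_1,\dots,X_n|H_n\}$ p-entails a conditional random quantity $X|H$ taking values in a finite subset of $[0,1]$ if, for every coherent prevision assessment $(\mu_1,\dots,\mu_n,\zeta)$ on $\{X_1|H_1,\dots,X_n|H_n,\;X|H\}$,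 $\mu_1=\cdots=\mu_n=1$ implies $\zeta=1$. The inference from the family to $X|H$ is p-valid if the family p-entails $X|H$. *)

(* Defs.v *)
From HB Require Import structures.
From mathcomp Require Import all_boot all_order all_algebra.
From mathcomp Require Import boolp classical_sets functions cardinality reals.
From mathcomp Require Import numfun.
Set Implicit Arguments.
Unset Strict Implicit.
Unset Printing Implicit Defensive.
Import Order.TTheory GRing.Theory Num.Theory.
Local Open Scope classical_set_scope.
Local Open Scope ring_scope.

(* Events are subsets of an arbitrary set T of elementary cases. *)

Definition logically_independent (T : Type) (n : nat) (E : 'I_n -> set T) :=
  forall b : 'I_n -> bool,
    \bigcap_(i in [set: 'I_n]) (if b i then E i else ~` E i) !=set0.

(* The numerical value X H + m ~H of X|H when its prevision is m. *)
Definition settle (R : realType) (T : Type) (X : T -> R) (H : set T) (m : R) :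
    T -> R :=
  fun w => X w * \1_H w + m * \1_(~` H) w.

(* Coherence of the prevision function mu on the family (X i | H i), i in F.
   A finite subfamily is an enumeration e of members of F, of length n.+1 >= 1;
   repetitions in e are harmless since the stakes of equal bets add up. *)
Section Coherence.
Variables (R : realType) (T I : Type).
Variables (X : I -> T -> R) (H : I -> set T) (mu : I -> R).

Definition gain n (e : 'I_n -> I) (s : 'I_n -> R) (w : T) : R :=
  \sum_(k < n) s k * \1_(H (e k)) w * (X (e k) w - mu (e k)).

Definition gain_values n (e : 'I_n -> I) (s : 'I_n -> R) : set R :=
  gain e s @` \bigcup_(k in [set: 'I_n]) H (e k).

Definition coherent (F : set I) : Prop :=
  forall (n : nat) (e : 'I_n.+1 -> I) (s : 'I_n.+1 -> R),
    (forall k, F (e k)) ->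
    exists m M : R,
      [/\ gain_values e s m, lbound (gain_values e s) m,
          gain_values e s M, ubound (gain_values e s) M & m <= 0 <= M].

End Coherence.

Lemma finite_range_indic (R : realType) (T : Type) (A : set T) :
  finite_set (range (\1_A : T -> R)).
Proof.
apply: (@sub_finite_set _ _ [set 0; 1]); last exact: finite_set2.
move=> _ [w _ <-]; rewrite indicE; case: (w \in A); first by right.
by left.
Qed.

(* [indic_fimfun] asks for a pointed domain. *)
Definition event_indicator (R : realType) (T : Type) (A : set T) :
    {fimfun T >-> R} :=
  HB.pack (\1_A : T -> R)
    (FiniteImage.Build T R \1_A (finite_range_indic R A)).

(* A conditional event A|H. *)
Record cevent (T : Type) :=
  CEvent { consequent : set T ; antecedent : set T }.

(* Conditional random quantities.  Conjunctions and iterated conditionals are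
   kept as formal expressions because their numerical values depend on the
   previsions assessed for their components; see [payoff] below. *)
Inductive crq (R : realType) (T : Type) : Type :=
| Cond of {fimfun T >-> R} & set T
| Conj of cevent T & cevent T
| Iter of cevent T & cevent T. (* Iter b a is b|a *)

Arguments Conj {R T}.
Arguments Iter {R T}.

Definition crq_of_cevent (R : realType) (T : Type) (a : cevent T) : crq R T :=
  Cond (event_indicator R (consequent a)) (antecedent a).

Section Previsions.
Variables (R : realType) (T : Type).
Implicit Types (a b : cevent T) (q : crq R T) (F : set (crq R T)).

(* The iterated conditional is unconditional: its bet is never called off. *)
Definition conditioning q : set T :=
  match q with
  | Cond _ H => H
  | Conj a b => antecedent a `|` antecedent b
  | Iter _ _ => setT
  end.

(* The quantities whose previsions enter the definition of q. *)
Definition components q : set (crq R T) :=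
  match q with
  | Cond _ _ => set0
  | Conj a b => [set crq_of_cevent R a; crq_of_cevent R b]
  | Iter b a => [set crq_of_cevent R a; crq_of_cevent R b; Conj b a]
  end.

Definition with_components F : set (crq R T) :=
  F `|` \bigcup_(q in F) components q.

Variable P : crq R T -> R.

Definition cevent_value a : T -> R :=
  settle \1_(consequent a) (antecedent a) (P (crq_of_cevent R a)).

(* The value of ~A|H, with prevision 1 - P(A|H). *)
Definition neg_cevent_value a : T -> R :=
  settle \1_(~` consequent a) (antecedent a) (1 - P (crq_of_cevent R a)).

Definition conj_payoff a b : T -> R :=
  fun w => Num.min (cevent_value a w) (cevent_value b w).

Definition conj_value a b : T -> R :=
  settle (conj_payoff a b) (antecedent a `|` antecedent b) (P (Conj a b)).

Definition payoff q : T -> R :=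
  match q with
  | Cond X _ => X
  | Conj a b => conj_payoff a b
  | Iter b a =>
      fun w => conj_value b a w + P (Iter b a) * neg_cevent_value a w
  end.

Definition value q : T -> R := settle (payoff q) (conditioning q) (P q).

Definition unit_valued q : Prop :=
  finite_set (range (value q)) /\ (forall w, 0 <= value q w <= 1).

(* An assessment on F involves the previsions of the components of its members,
   without which the members of F are not defined as random quantities. *)
Definition coherent_assessment F : Prop :=
  coherent payoff conditioning P (with_components F).

End Previsions.

Definition p_consistent (R : realType) (T : Type) (F : set (crq R T)) : Prop :=
  finite_set F /\
  exists P : crq R T -> R,
    [/\ coherent_assessment P F,
        forall q, F q -> unit_valued P q &
        forall q, F q -> P q = 1].

(* The values of the quantities are not assumed to lie in [0, 1] here: such an
   assumption would only exclude some of the assessments P. *)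
Definition p_entails (R : realType) (T : Type)
    (F : set (crq R T)) (q : crq R T) : Prop :=
  p_consistent F /\
  forall P : crq R T -> R,
    coherent_assessment P (F `|` [set q]) ->
    (forall p, F p -> P p = 1) -> P q = 1.

Definition p_valid (R : realType) (T : Type)
    (F : set (crq R T)) (q : crq R T) : Prop := p_entails F q.

(* Main.v *)
Require Import Defs.
From mathcomp Require Import all_boot all_order all_algebra.
From mathcomp Require Import boolp classical_sets functions cardinality reals.
From mathcomp Require Import numfun lra.
Set Implicit Arguments.
Unset Strict Implicit.
Unset Printing Implicit Defensive.
Local Open Scope classical_set_scope.
Import Order.TTheory GRing.Theory Num.Theory.
Local Open Scope ring_scope.

(** Betting on one quantity against another shows that a coherent assessment
    gives the conjunction at most the prevision of each of its members, so
    prevision 1 of the conjunction forces x = y = 1.  The iterated conditional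
    is then determined by mu alone.  Betting on it if mu > 1, or against it if
    mu < 1, together with a unit bet on the conjunction is a sure loss: the
    second bet costs 1 exactly where the first one is neutral.

    For p-consistency, on A H B K all the quantities involved equal 1, so every
    gain vanishes there, and gains take finitely many values. *)

Lemma finite_range_of_finType (C : finType) (T U : Type) (c : T -> C)
    (f : T -> U) :
  (forall v w, c v = c w -> f v = f w) -> finite_set (range f).
Proof.
move=> fc; case: (pselect (exists w : T, True)) => [[w0 _]|noT]; last first.
  rewrite (_ : range f = set0); first exact: finite_set0.
  by apply/seteqP; split=> // u [w _ _]; apply: noT; exists w.
(* One representative per class that [c] attains; [w0] is a dummy for the others, so [f \o rep] on
   the finite type [C] already covers the range. *)
pose rep i := if pselect (exists w, c w = i) is left ex then projT1 (cid ex)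
              else w0.
apply: (@sub_finite_set _ _ (range (f \o rep))); last first.
  by apply: finite_image; apply: finite_finset.
move=> _ [w _ <-]; exists (c w) => //=; rewrite /rep.
case: pselect => [ex|[]]; last by exists w.
by apply: fc; exact: (projT2 (cid ex)).
Qed.

Lemma finite_set_min_max (R : realType) (D : set R) :
  finite_set D -> D !=set0 ->
  exists m M, [/\ D m, lbound D m, D M & ubound D M].
Proof.
move=> /finite_seqP[s ->] [x0 /= x0s].
pose i0 : seq_sub s := SeqSub x0s.
case: (Order.TotalTheory.arg_minP val (isT : xpredT i0)) => m _ mP.
case: (Order.TotalTheory.arg_maxP val (isT : xpredT i0)) => M _ MP.
exists (val m), (val M); split; [exact: ssvalP| |exact: ssvalP|] => x /= xs.
  exact: (mP (SeqSub xs)).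
exact: (MP (SeqSub xs)).
Qed.

Section Coherence.
Variables (R : realType) (T I : Type).
Variables (X : I -> T -> R) (H : I -> set T) (mu : I -> R) (F : set I).

(** A point of maximal gain serves as [w], since coherence makes the maximum nonnegative. All
    inequalities on [P] below come from this form. *)
Lemma coherent_two_bets (p q : I) (s t : R) :
  coherent X H mu F -> F p -> F q ->
  exists2 w, w \in H p `|` H q &
    0 <= s * \1_(H p) w * (X p w - mu p) + t * \1_(H q) w * (X q w - mu q).
Proof.
move=> coh Fp Fq.
have Fpq (k : 'I_2) : F (if k == ord0 then p else q) by case: ifP.
(* Coherence enumerates [n.+1] bets, so [1] here means two. *)
have [m [M [_ _ [w [k _ Hw] gw] _ /andP[_ M0]]]] :=
  coh 1%N _ (fun k => if k == ord0 then s else t) Fpq.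
exists w.
  by rewrite inE; move: Hw; case: ifP => _ ?; [left|right].
by move: M0; rewrite -gw /gain !big_ord_recl big_ord0 addr0.
Qed.

(** The map [c] plays the role of the constituent containing a point: gains depend on the point only
    through it, so extrema exist, and they enclose the gain 0 at [w0]. *)
Lemma coherent_fair_point (C : finType) (c : T -> C) (w0 : T) :
  (forall i, F i -> forall v w, c v = c w ->
     X i v = X i w /\ (v \in H i) = (w \in H i)) ->
  (forall i, F i -> H i w0 /\ X i w0 = mu i) ->
  coherent X H mu F.
Proof.
move=> fc fair n e s Fe.
have gain0 : gain_values X H mu e s 0.
  exists w0; first by exists ord0 => //; exact: (fair _ (Fe _)).1.
  by rewrite /gain big1// => k _; rewrite (fair _ (Fe k)).2 subrr mulr0.
have fin : finite_set (gain_values X H mu e s).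
  apply: (@sub_finite_set _ _ (range (gain X H mu e s))).
    by move=> _ [w _ <-]; exists w.
  apply: (@finite_range_of_finType _ _ _ c) => v w cvw.
  apply: eq_bigr => k _; have [Xvw Hvw] := fc _ (Fe k) _ _ cvw.
  by rewrite !indicE Xvw Hvw.
have [|m [M [Dm lm DM uM]]] := finite_set_min_max fin; first by exists 0.
by exists m, M; split=> //; rewrite lm// uM.
Qed.

End Coherence.

Section Previsions.
Variables (R : realType) (T : Type) (P : crq R T -> R) (F : set (crq R T)).
Hypothesis coh : coherent (payoff P) (@conditioning R T) P F.
Implicit Types a b : cevent T.

Lemma coherent_cevent_le1 a :
  F (crq_of_cevent R a) -> P (crq_of_cevent R a) <= 1.
Proof.
(* A single bet, padded with a zero stake. *)
move=> Fa; have [w] := coherent_two_bets 1 0 coh Fa Fa.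
rewrite setUid /= => Hw; rewrite !indicE Hw.
by case: (w \in _) => /=; lra.
Qed.

Lemma conj_payoffC a b : conj_payoff P a b = conj_payoff P b a.
Proof. by apply/funext => w; rewrite /conj_payoff minC. Qed.

(** The two orders are distinct formal terms with the same payoff and conditioning event, so
    opposite bets on them give a constant gain, the difference of the previsions. *)
Lemma coherent_conjC a b : F (Conj a b) -> F (Conj b a) ->
  P (Conj a b) = P (Conj b a).
Proof.
suff le c d : F (Conj c d) -> F (Conj d c) -> P (Conj c d) <= P (Conj d c).
  by move=> Fab Fba; apply/le_anti; rewrite !le.
move=> Fcd Fdc; have [w] := coherent_two_bets 1 (-1) coh Fcd Fdc.
rewrite /= [antecedent d `|` _]setUC setUid => Hw.
by rewrite !indicE Hw (conj_payoffC d c) /=; lra.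
Qed.

(** Buying the conjunction and selling [a] gains at most the difference of the previsions: where the
    bet on [a] is called off, the minimum is still bounded by [P] of [a]. *)
Lemma coherent_conj_le_left a b : F (Conj a b) -> F (crq_of_cevent R a) ->
  P (Conj a b) <= P (crq_of_cevent R a).
Proof.
move=> Fab Fa; have [w] := coherent_two_bets 1 (-1) coh Fab Fa.
have := ge_min (cevent_value P a w) (cevent_value P a w) (cevent_value P b w).
rewrite lexx /= -/(conj_payoff P a b w) /cevent_value /settle.
rewrite !indicE !in_setU in_setC.
by case: (w \in antecedent a); case: (w \in antecedent b) => //=; lra.
Qed.

Lemma coherent_conj_le_right a b : F (Conj a b) -> F (crq_of_cevent R b) ->
  P (Conj a b) <= P (crq_of_cevent R b).
Proof.
move=> Fab Fb; have [w] := coherent_two_bets 1 (-1) coh Fab Fb.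
have := ge_min (cevent_value P b w) (cevent_value P a w) (cevent_value P b w).
rewrite lexx orbT /= -/(conj_payoff P a b w) /cevent_value /settle.
rewrite !indicE !in_setU in_setC.
by case: (w \in antecedent a); case: (w \in antecedent b) => //=; lra.
Qed.

Lemma coherent_iter_eq1 a b :
  F (crq_of_cevent R a) -> F (crq_of_cevent R b) ->
  F (Conj b a) -> F (Iter b a) -> P (Conj b a) = 1 -> P (Iter b a) = 1.
Proof.
move=> Fa Fb Fba Fit z1.
have y1 : P (crq_of_cevent R b) = 1.
  apply/le_anti; rewrite coherent_cevent_le1//= -z1; exact: coherent_conj_le_left.
have x1 : P (crq_of_cevent R a) = 1.
  apply/le_anti; rewrite coherent_cevent_le1//= -z1; exact: coherent_conj_le_right.
(* Where both antecedents fail, the bet on the conjunction is off, but the iterated conditional pays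
   [P (Conj b a) = 1], so the first bet alone loses. *)
apply/le_anti/andP; split; rewrite leNgt; apply/negP => mu1;
  [have [w _] := coherent_two_bets 1 1 coh Fit Fba
  |have [w _] := coherent_two_bets (-1) 1 coh Fit Fba];
  rewrite /= /conj_value /neg_cevent_value /conj_payoff /cevent_value /settle;
  rewrite !indicE !(in_setC, in_setU) z1 x1 y1 in_setT;
  case: (w \in consequent a); case: (w \in consequent b);
  case: (w \in antecedent a); case: (w \in antecedent b) => /=;
  rewrite !(subrr, mul0r, mulr0, mulr1, mul1r, add0r, addr0) /Num.min;
  rewrite ?(ltxx, ltr01, ltr10) /=; lra.
Qed.

End Previsions.

Section Consistency.
Variables (R : realType) (T : Type).
Implicit Types a b : cevent T.

Lemma conj_p_consistent a b (w0 : T) :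
  consequent a w0 -> antecedent a w0 -> consequent b w0 -> antecedent b w0 ->
  p_consistent [set (Conj a b : crq R T)].
Proof.
move=> Aw0 Hw0 Bw0 Kw0; split; first exact: finite_set1.
pose c w := (w \in consequent a, w \in antecedent a,
             w \in consequent b, w \in antecedent b).
exists (fun=> 1); split=> [|_ ->|//].
  apply: (@coherent_fair_point _ _ _ _ _ _ _ _ c w0).
    move=> _ [->|[_ -> [->|->]]] v w [Ea Eh Eb Ek] /=;
    by rewrite /conj_payoff /cevent_value /settle ?indicE ?in_setC ?in_setU
               ?Ea ?Eh ?Eb ?Ek.
  move=> _ [->|[_ -> [->|->]]] /=; split=> //; try by left.
  - rewrite /conj_payoff /cevent_value /settle !indicE !in_setC !mem_set//=.
    by rewrite !mulr1 mulr0 addr0 minxx.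
  - by rewrite indicE mem_set.
  - by rewrite indicE mem_set.
split.
  apply: (finite_range_of_finType (c := c)) => v w [Ea Eh Eb Ek].
  by rewrite /value /= /settle /conj_payoff /cevent_value /settle
             !indicE !(in_setC, in_setU) ?Ea ?Eh ?Eb ?Ek.
(* With all previsions 1, every value is 0 or 1. *)
move=> w; rewrite /value /= /settle /conj_payoff /cevent_value /settle.
rewrite !indicE !(in_setC, in_setU).
case: (w \in consequent a); case: (w \in consequent b);
case: (w \in antecedent a); case: (w \in antecedent b) => /=;
rewrite ?(mul0r, mulr0, mulr1, mul1r, add0r, addr0) /Num.min;
rewrite ?(ltxx, ltr01, ltr10) /=; lra.
Qed.

End Consistency.

Theorem mainTheorem8 (R : realType) (T : Type) (A B H K : set T)
    (indep : logically_independent (tnth [tuple A; B; H; K])) :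
  let AH := CEvent A H in
  let BK := CEvent B K in
  p_valid [set (Conj AH BK : crq R T)] (Iter BK AH) /\
  p_entails [set (Conj BK AH : crq R T)] (Iter BK AH).
Proof.
move=> AH BK.
(* Negating none of the events yields a point of A H B K. *)
have [w0 w0E] := indep xpredT.
have Aw0 : A w0 by exact: (w0E ord0).
have Bw0 : B w0 by exact: (w0E (@Ordinal 4 1 isT)).
have Hw0 : H w0 by exact: (w0E (@Ordinal 4 2 isT)).
have Kw0 : K w0 by exact: (w0E (@Ordinal 4 3 isT)).
have memF (F : set (crq R T)) q : components (Iter BK AH) q ->
    with_components (F `|` [set Iter BK AH]) q.
  by right; exists (Iter BK AH) => //; right.
have memI (F : set (crq R T)) :
    with_components (F `|` [set Iter BK AH]) (Iter BK AH) by left; right.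
split; (split; [exact: (@conj_p_consistent _ _ _ _ w0)|]) => P coh P1.
  apply: (coherent_iter_eq1 coh).
  - by apply: memF; left; left.
  - by apply: memF; left; right.
  - by apply: memF; right.
  - exact: memI.
  (* The premise has the opposite order to the conjunction inside [Iter BK AH]. *)
  - rewrite -(coherent_conjC coh (a := AH)); first exact: P1.
      by left; left.
    by apply: memF; right.
apply: (coherent_iter_eq1 coh).
- by apply: memF; left; left.
- by apply: memF; left; right.
- by apply: memF; right.
- exact: memI.
- exact: P1.
Qed.
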